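(* Any differential operator $L\in\hat{\mathscr W}$ admits a decomposition into the noncommutative product of monic operators, where a differential operator in $\hat{\mathscr W}$ is called monic if it has a single slope and the corresponding characteristic polynomial has a single root.
   Context: $\hat{\mathscr W}$ is the noncommutative $\mathbb C$-algebra of formal differential operators: formal series in $t$ and $\epsilon$, polynomial in $\epsilon$, where $\epsilon=t\frac{d}{dt}$ is the Euler derivation, multiplication is composition, and $\epsilon^j t^k=t^k(\epsilon+k)^j$. Every $L\in\hat{\mathscr W}$ is written uniquely with powers of $t$ on the left: $L=\sum_{(i,j)}c_{ij}t^j\epsilon^i$ with $0\le i\le n$, $j\ge 0$, where $n$ is the order of $L$. The support of $L$ is $\{(i,j):c_{ij}\ne0\}$, and the pseudosymbol of $L$ is the commutative expression $\sum c_{ij}t^j\xi^i\in\mathbb C[[t]][\xi]$. The Newton polygon $\Delta_L\subset\mathbb R_+^2$ is the minimal closed convex set which contains the origin $(0,0)$ and the support of $L$ and is invariant under the translation $(i,j)\mapsto(i,j+1)$. It is the epigraph of a convex non-decreasing piecewise-affine function $\chi:[0,n]\to\mathbb R_+$ with $\chi(0)=0$. $L$ is single-slope with slope $\rho\in\mathbb Q$, $\rho\ge0$, if the set of slopes of the affine pieces of $\chi$ is $\{\rho\}$, i.e., $\chi(x)=\rho x$; the value $\rho=0$ is not excluded. For a single-slope $L$ with slope $\rho=p/q$ in lowest terms ($p=0$, $q=1$ if $\rho=0$), give the monomial $t^j\xi^i$ the weight $j-\rho i$. The leading part $P_*$ of the pseudosymbol is the sum of its terms of minimal weight. It is written uniquely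 as $P_*(t,\xi)=c\,t^j\xi^i\prod_{s=1}^k(\lambda_s-t^p\xi^q)$ with $c\prod_s\lambda_s\neq0$. The characteristic polynomial $\sigma_L\in\mathbb C[\lambda]$ is the univariate polynomial $c\prod_{s=1}^k(\lambda_s-\lambda)$, whose (nonzero) roots are $\lambda_1,\dots,\lambda_k$. A single root may be multiple.
   Formalization: The operator L is assumed to have positive order (t and 0 have no such decomposition), and a monic operator may have a constant characteristic polynomial, i.e. at most one root is required, since otherwise ε itself would have no decomposition. *)

(* Defs.v *)
From HB Require Import structures.
From mathcomp Require Import all_boot all_order all_algebra.
From mathcomp Require Import complex.
From mathcomp Require Import boolp classical_sets reals topology normedtype convex.

Set Implicit Arguments.
Unset Strict Implicit.
Unset Printing Implicit Defensive.

Import Order.TTheory GRing.Theory Num.Theory.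
Import numFieldNormedType.Exports.

Local Open Scope ring_scope.

Definition bounded_size (K : comNzRingType) (f : nat -> {poly K}) :=
  exists n, forall j, (size (f j) <= n)%N.

(* L = \sum_j t^j L_j(eps), powers of t on the left, stored as the sequence of
   the polynomials L_j; the degrees in eps of the L_j are uniformly bounded. *)
Record diffop (K : comNzRingType) := Diffop {
  dcoef :> nat -> {poly K};
  dcoef_bounded : bounded_size dcoef
}.

HB.instance Definition _ (K : comNzRingType) := gen_eqMixin (diffop K).
HB.instance Definition _ (K : comNzRingType) := gen_choiceMixin (diffop K).

Section DiffopRing.
Variable K : comNzRingType.
Implicit Types L M N : diffop K.

Lemma diffopP L M : L =1 M -> L = M.
Proof.
case: L M => [l lb] [m mb] /= /funext lm; subst m.
by congr Diffop; exact: Prop_irrelevance.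
Qed.

(* p(eps) t^k = t^k p(eps + k) *)
Definition shiftp (k : nat) (p : {poly K}) : {poly K} := p \Po ('X + k%:R%:P).

Lemma shiftp0 p : shiftp 0 p = p.
Proof. by rewrite /shiftp addr0 comp_polyXr. Qed.

Lemma shiftpD k p q : shiftp k (p + q) = shiftp k p + shiftp k q.
Proof. exact: comp_polyD. Qed.

Lemma shiftpM k p q : shiftp k (p * q) = shiftp k p * shiftp k q.
Proof. exact: comp_polyM. Qed.

Lemma shiftpC k c : shiftp k c%:P = c%:P.
Proof. exact: comp_polyC. Qed.

Lemma shiftp_sum k I (r : seq I) (P : pred I) (F : I -> {poly K}) :
  shiftp k (\sum_(i <- r | P i) F i) = \sum_(i <- r | P i) shiftp k (F i).
Proof.
by apply: (big_morph (shiftp k) (shiftpD k)); rewrite /shiftp comp_poly0.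
Qed.

Lemma shiftp_shiftp j k p : shiftp j (shiftp k p) = shiftp (j + k)%N p.
Proof.
rewrite /shiftp -comp_polyA comp_polyD comp_polyX comp_polyC.
by rewrite -addrA -polyCD -natrD.
Qed.

Lemma size_shiftp k p : (size (shiftp k p) <= (size p).+1)%N.
Proof.
apply: leq_trans (size_comp_poly_leq _ _) _.
by rewrite size_XaddC muln1 ltnS leq_pred.
Qed.

Lemma diffop0_bounded : bounded_size (fun=> 0 : {poly K}).
Proof. by exists 0%N => j; rewrite size_poly0. Qed.
Definition diffop0 : diffop K := Diffop diffop0_bounded.

Lemma diffopN_bounded L : bounded_size (fun j => - L j).
Proof. by case: L => l [n ln]; exists n => j; rewrite size_polyN. Qed.
Definition diffopN L : diffop K := Diffop (diffopN_bounded L).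

Lemma diffopD_bounded L M : bounded_size (fun j => L j + M j).
Proof.
case: L M => l [n ln] [m [k mk]]; exists (maxn n k) => j /=.
apply: leq_trans (size_polyD _ _) _.
by rewrite geq_max !leq_max ln mk orbT.
Qed.
Definition diffopD L M : diffop K := Diffop (diffopD_bounded L M).

Lemma diffop_addrA : associative diffopD.
Proof. by move=> L M N; apply: diffopP => j /=; rewrite addrA. Qed.
Lemma diffop_addrC : commutative diffopD.
Proof. by move=> L M; apply: diffopP => j /=; rewrite addrC. Qed.
Lemma diffop_add0r : left_id diffop0 diffopD.
Proof. by move=> L; apply: diffopP => j /=; rewrite add0r. Qed.
Lemma diffop_addNr : left_inverse diffop0 diffopN diffopD.
Proof. by move=> L; apply: diffopP => j /=; rewrite addNr. Qed.

HB.instance Definition _ := GRing.isZmodule.Build (diffop K)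
  diffop_addrA diffop_addrC diffop_add0r diffop_addNr.

(* t^k p(eps) *)
Lemma dmono_bounded k (p : {poly K}) :
  bounded_size (fun j => if j == k then p else 0).
Proof. by exists (size p) => j; case: ifP; rewrite ?size_poly0. Qed.
Definition dmono k (p : {poly K}) : diffop K := Diffop (dmono_bounded k p).

Lemma diffopM_bounded L M : bounded_size
  (fun j => \sum_(i < j.+1) shiftp (j - i) (L i) * M (j - i)%N).
Proof.
case: L M => l [n ln] [m [k mk]]; exists (n.+1 + k)%N => j /=.
apply: leq_trans (size_sum _ _ _) _; apply/bigmax_leqP => i _.
apply: leq_trans (size_polyMleq _ _) _; apply: leq_trans (leq_pred _) _.
by apply: leq_add (mk _); apply: leq_trans (size_shiftp _ _) _; rewrite ltnS.
Qed.
(* t^i p(eps) * t^k q(eps) = t^(i + k) p(eps + k) q(eps) *)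
Definition diffopM L M : diffop K := Diffop (diffopM_bounded L M).

Lemma diffopM_rev L M j : diffopM L M j =
  \sum_(i < j.+1) shiftp i (L (j - i)%N) * M i.
Proof.
rewrite /= (reindex_inj rev_ord_inj) /=.
by apply: eq_bigr => i _; rewrite subSS subKn // -ltnS.
Qed.

Lemma diffop_mulrA : associative diffopM.
Proof.
move=> L M N; apply: diffopP => n; rewrite [RHS]diffopM_rev.
pose f j k := shiftp (n - j) (L j) * shiftp k (M (n - j - k)%N) * N k.
transitivity (\sum_(j < n.+1) \sum_(k < n.+1 | (k <= n - j)%N) f j k).
  apply: eq_bigr => j _; rewrite diffopM_rev big_distrr /=.
  rewrite (big_ord_narrow_leq (leq_subr _ _)).
  by apply: eq_bigr => k _; rewrite mulrA.
rewrite (exchange_big_dep predT) //=; apply: eq_bigr => k _.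
transitivity (\sum_(j < n.+1 | (j <= n - k)%N) f j k).
  apply: eq_bigl => j; rewrite -ltnS -(ltnS j) -!subSn ?leq_ord //.
  by rewrite -subn_gt0 -(subn_gt0 j) -!subnDA addnC.
rewrite (big_ord_narrow_leq (leq_subr _ _)) shiftp_sum big_distrl /=.
apply: eq_bigr => i _; rewrite /f shiftpM shiftp_shiftp.
have le_kn : (k <= n)%N by rewrite -ltnS.
have le_in : (i <= n - k)%N by rewrite -ltnS.
have -> : (n - i = k + (n - k - i))%N by rewrite addnBA ?subnKC.
by rewrite addKn.
Qed.

Lemma diffop_mul1r : left_id (dmono 0 1) diffopM.
Proof.
move=> L; apply: diffopP => j; rewrite /= big_ord_recl /= subn0.
rewrite [shiftp _ _]shiftpC mul1r big1 ?addr0 // => i _.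
by rewrite /shiftp comp_poly0 mul0r.
Qed.

Lemma diffop_mulr1 : right_id (dmono 0 1) diffopM.
Proof.
move=> L; apply: diffopP => j; rewrite diffopM_rev big_ord_recl /= subn0.
by rewrite shiftp0 mulr1 big1 ?addr0 // => i _; rewrite mulr0.
Qed.

Lemma diffop_mulrDl : left_distributive diffopM +%R.
Proof.
move=> L M N; apply: diffopP => j /=; rewrite -big_split /=.
by apply: eq_bigr => i _; rewrite shiftpD mulrDl.
Qed.

Lemma diffop_mulrDr : right_distributive diffopM +%R.
Proof.
move=> L M N; apply: diffopP => j /=; rewrite -big_split /=.
by apply: eq_bigr => i _; rewrite mulrDr.
Qed.

Lemma diffop_oner_neq0 : dmono 0 1 != 0.
Proof.
apply/eqP => /(congr1 (fun L : diffop K => L 0%N)) /= /eqP.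
by rewrite oner_eq0.
Qed.

HB.instance Definition _ := GRing.Zmodule_isNzRing.Build (diffop K)
  diffop_mulrA diffop_mul1r diffop_mulr1 diffop_mulrDl diffop_mulrDr
  diffop_oner_neq0.

Definition dt : diffop K := dmono 1 1.
Definition deps : diffop K := dmono 0 'X.

Lemma dmonoM i k p q : dmono i p * dmono k q = dmono (i + k)%N (shiftp k p * q).
Proof.
apply: diffopP => j /=.
have [->|jik] := eqVneq j (i + k)%N.
  have li : (i < (i + k).+1)%N by rewrite ltnS leq_addr.
  rewrite (bigD1 (Ordinal li)) //= eqxx addKn eqxx big1 ?addr0 // => l li'.
  have /negPf -> : (l : nat) != i by apply: contraNneq li' => E; apply/eqP/val_inj.
  by rewrite /shiftp comp_poly0 mul0r.
rewrite big1 // => l _; have [E|_] := eqVneq (l : nat) i; last first.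
  by rewrite /shiftp comp_poly0 mul0r.
have /negPf -> : (j - l)%N != k; last by rewrite mulr0.
apply: contraNneq jik => <-; rewrite -E subnKC //.
by rewrite -ltnS.
Qed.

Lemma dmonoD k p q : dmono k (p + q) = dmono k p + dmono k q.
Proof. by apply: diffopP => j /=; case: ifP; rewrite ?addr0. Qed.

Lemma dmono_nat n : n%:R = dmono 0 n%:R.
Proof.
elim: n => [|n IH]; last by rewrite -!natr1 dmonoD IH.
by apply: diffopP => j /=; case: ifP.
Qed.

Lemma dmono_exp p n : dmono 0 p ^+ n = dmono 0 (p ^+ n).
Proof. by elim: n => // n IH; rewrite !exprS IH dmonoM shiftp0. Qed.

Lemma dt_exp k : dt ^+ k = dmono k 1.
Proof. by elim: k => // k IH; rewrite exprS IH dmonoM shiftpC mul1r. Qed.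

Lemma deps_dt j k : deps ^+ j * dt ^+ k = dt ^+ k * (deps + k%:R) ^+ j.
Proof.
rewrite dt_exp dmono_exp dmonoM dmono_nat -dmonoD dmono_exp dmonoM shiftp0.
rewrite addn0 mulr1 mul1r; congr (dmono k _).
elim: j => [|j IH]; first by rewrite !expr0 [shiftp _ _]shiftpC.
by rewrite !exprS shiftpM IH {1}/shiftp comp_polyX rmorph_nat.
Qed.

Lemma dmonoE k p : dmono k p = dt ^+ k * \sum_(i < size p) dmono 0 (p`_i)%:P * deps ^+ i.
Proof.
have -> : \sum_(i < size p) dmono 0 (p`_i)%:P * deps ^+ i = dmono 0 p.
  under eq_bigr do rewrite dmono_exp dmonoM shiftp0 mul_polyC.
  rewrite -[in RHS](coefK p) poly_def.
  by apply/esym/(big_morph (dmono 0) (dmonoD 0)); apply: diffopP => j /=; case: ifP.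
by rewrite dt_exp dmonoM shiftp0 addn0 mul1r.
Qed.

(* c_ij, the coefficient of t^j eps^i (or of t^j xi^i in the pseudosymbol) *)
Definition dcf L (i j : nat) : K := (L j)`_i.

Lemma diffop_size_bounded L : exists n, `[< forall j, (size (L j) <= n.+1)%N >].
Proof. by case: L => l [n ln]; exists n; apply/asboolP => j; exact: leqW. Qed.
(* The degree in eps; it is 0 for the zero operator. *)
Definition dorder L : nat := ex_minn (diffop_size_bounded L).

End DiffopRing.

Section NewtonPolygon.
Variable R : realType.
Implicit Type L : diffop R[i].
Local Open Scope classical_set_scope.

Definition dsupport L : set (R^o * R^o) :=
  [set z | exists i j : nat, dcf L i j != 0 /\ z = (i%:R, j%:R)].

Definition up_invariant (A : set (R^o * R^o)) :=
  forall x y, A (x, y) -> A (x, y + 1).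

Definition newton_polygon L : set (R^o * R^o) :=
  smallest [set A | [/\ closed A,
                        convex_set (A : set (convex_lmodType (R^o * R^o)%type))
                      & up_invariant A]]
           ((0, 0) |` dsupport L).

Definition epigraph (n : nat) (chi : R -> R) : set (R^o * R^o) :=
  [set z | 0 <= z.1 <= n%:R /\ chi z.1 <= z.2].

(* For dorder L = 0 the function chi lives on a point and has no affine pieces,
   hence no slopes. *)
Definition single_slope L (rho : rat) :=
  [/\ (0 < dorder L)%N, 0 <= rho
    & newton_polygon L = epigraph (dorder L) (fun x => ratr rho * x)].

Definition weight (rho : rat) (i j : nat) : rat := j%:R - rho * i%:R.

Definition minimal_term L rho i j :=
  dcf L i j != 0 /\
  forall i' j', dcf L i' j' != 0 -> weight rho i j <= weight rho i' j'.

(* P(t, xi) is a polynomial in xi = 'X over the polynomials in t = 'X%:P. *)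
Definition is_leading_part L rho (P : {poly {poly R[i]}}) :=
  (forall i j, minimal_term L rho i j -> P`_i`_j = dcf L i j) /\
  (forall i j, ~ minimal_term L rho i j -> P`_i`_j = 0).

Definition is_char_poly L rho (sigma : {poly R[i]}) :=
  let p := `|numq rho|%N in let q := `|denq rho|%N in
  exists P c i j (lam : seq R[i]),
  [/\ is_leading_part L rho P, c != 0, 0 \notin lam,
      P = c%:P%:P * ('X^j)%:P * 'X^i
            * \prod_(l <- lam) (l%:P%:P - ('X^p)%:P * 'X^q)
    & sigma = c%:P * \prod_(l <- lam) (l%:P - 'X)].

(* All roots of sigma, with multiplicity disregarded, coincide.  The factor
   t^j xi^i of the leading part contributes no root, so sigma is constant when
   the leading part is a monomial (e.g. for eps, or t eps): such a sigma has no
   two distinct roots, and the operator counts as monic. *)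
Definition single_root (sigma : {poly R[i]}) :=
  exists l : R[i], forall a, root sigma a -> a = l.

Definition monic_op L :=
  exists rho sigma,
  [/\ single_slope L rho, is_char_poly L rho sigma & single_root sigma].

End NewtonPolygon.

(* Main.v *)
(* Let p/q be the smallest slope j/i over the terms t^j eps^i of L with i > 0, so
   that all weights q j - p i are nonnegative and the part of weight 0 is a
   polynomial Q = f(xi^q) once t is set to 1.  If Q = A0 B0, then L = A B with A, B
   of leading parts A0, B0: weight by weight, one solves
   twist_k(A0) y + x B0 = r, with y reduced modulo B0, so that deg A + deg B does
   not exceed the order n of L.  Solvability needs B0 coprime to A0 or, for slope 0
   (where the shift eps -> eps + k intervenes), to all the A0(xi + k), k > 0.
   If deg Q < n, take B0 = Q and A0 = 1.  If deg Q = n, the operator has the single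
   slope p/q, and it is monic unless f has two distinct roots; in that case take
   B0 = (xi^q - x)^m for a root x of f, of multiplicity m, such that no x + k is a
   root.  Both factors have smaller positive order, and one concludes by induction. *)
Require Import Defs.
From mathcomp Require Import all_boot all_order all_algebra.
From mathcomp Require Import complex reals interval_inference.
From mathcomp Require Import boolp classical_sets topology normedtype convex.
From mathcomp Require Import zify ring lra.

Set Implicit Arguments.
Unset Strict Implicit.
Unset Printing Implicit Defensive.

Import Order.TTheory GRing.Theory Num.Theory.
Import numFieldNormedType.Exports.

Local Open Scope ring_scope.

(** * Orders of operators and of their products *)

Section Order.
Variable K : fieldType.
Implicit Types (L M N : diffop K) (f g : {poly K}).

Lemma size_shiftpE k f : size (shiftp k f) = size f.
Proof. by rewrite size_comp_poly2 // size_XaddC. Qed.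

(** Translating the variable keeps the leading coefficient, and [i] is at least the degree of
    [f]. *)
Lemma coef_shiftp_top k f i : (size f <= i.+1)%N -> (shiftp k f)`_i = f`_i.
Proof.
rewrite leq_eqVlt => /orP[/eqP sf|]; last first.
  by rewrite ltnS => sf; rewrite !nth_default ?size_shiftpE.
have := @lead_coef_comp _ f ('X + k%:R%:P); rewrite size_XaddC.
move=> /(_ isT); rewrite lead_coefE -/(shiftp k f) size_shiftpE sf /=.
rewrite -[k%:R%:P]opprK -polyCN lead_coefXsubC expr1n mulr1.
by rewrite lead_coefE sf.
Qed.

Lemma diffopM_coef L M j :
  (L * M) j = \sum_(i < j.+1) shiftp (j - i) (L i) * M (j - i)%N.
Proof. by []. Qed.

Lemma dcfE L i j : dcf L i j = (L j)`_i. Proof. by []. Qed.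

Lemma dcfD L M i j : dcf (L + M) i j = dcf L i j + dcf M i j.
Proof. by rewrite /dcf coefD. Qed.

Lemma dcfN L i j : dcf (- L) i j = - dcf L i j.
Proof. by rewrite /dcf coefN. Qed.

Lemma dcfB L M i j : dcf (L - M) i j = dcf L i j - dcf M i j.
Proof. by rewrite dcfD dcfN. Qed.

Lemma dcfP L M : (forall i j, dcf L i j = dcf M i j) -> L = M.
Proof. by move=> LM; apply: diffopP => j; apply/polyP => i; exact: LM. Qed.

Lemma size_dorder L j : (size (L j) <= (dorder L).+1)%N.
Proof. by rewrite /dorder; case: ex_minnP => n /asboolP. Qed.

Lemma dorder_leq L n : (forall j : nat, size (L j) <= n.+1)%N -> (dorder L <= n)%N.
Proof. by move=> Ln; rewrite /dorder; case: ex_minnP => m _; apply; apply/asboolP. Qed.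

Lemma dcf_dorder L i j : dcf L i j != 0 -> (i <= dorder L)%N.
Proof.
apply: contraNleq => Li; apply/eqP/nth_default.
exact: leq_trans (size_dorder L j) Li.
Qed.

Lemma dorder_gt_dcf L n : (n < dorder L)%N ->
  exists i j, (n < i)%N /\ dcf L i j != 0.
Proof.
move=> nL; apply: contrapT => H; move: nL; rewrite ltnNge => /negP; apply.
apply: dorder_leq => j; apply/leq_sizeP => i ni; apply/eqP.
by apply: contrapT => /negP Hi; apply: H; exists i, j.
Qed.

Lemma size_diffopM L M a b :
    (forall j, size (L j) <= a.+1)%N -> (forall j, size (M j) <= b.+1)%N ->
  forall j : nat, (size ((L * M)%R j) <= (a + b).+1)%N.
Proof.
move=> La Mb j; rewrite diffopM_coef.
apply: leq_trans (size_sum _ _ _) _; apply/bigmax_leqP => i _.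
apply: leq_trans (size_polyMleq _ _) _; rewrite size_shiftpE.
move: (La i) (Mb (j - i)%N) => {La Mb}.
by case: (size _) => [|u]; case: (size _) => [|v] /=; lia.
Qed.

Lemma dorderM_leq L M : (dorder (L * M)%R <= dorder L + dorder M)%N.
Proof. by apply: dorder_leq; apply: size_diffopM; exact: size_dorder. Qed.

End Order.

(** * The weight filtration and its graded parts *)

(* For the slope [p / q], the term [t^j eps^i] has weight [q j - p i]. *)
Section Weight.
Variables (K : fieldType) (p q : nat).
Hypothesis q_gt0 : (0 < q)%N.
Implicit Types (L M N : diffop K) (f g : {poly K}).

Definition weight_ge k L := forall i j, (q * j < p * i + k)%N -> dcf L i j = 0.

(* The part of weight [k] with [t] specialised to [1]; no term is lost, since
   [i] and [k] determine [j]. *)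
Definition weight_part k L : {poly K} :=
  \poly_(i < (dorder L).+1)
    (if (q %| p * i + k)%N then dcf L i ((p * i + k) %/ q)%N else 0).

Definition weight_class k : {pred {poly K}} :=
  [pred f : {poly K} | [forall i : 'I_(size f), (f`_i != 0) ==> (q %| p * i + k)%N]].

Lemma weight_classP k f :
  reflect (forall i, f`_i != 0 -> (q %| p * i + k)%N) (f \in weight_class k).
Proof.
apply: (iffP forallP) => [H i fi|H i]; last by apply/implyP/H.
have lti : (i < size f)%N by rewrite ltnNge; apply: contraNN fi => /(nth_default 0) ->.
by have /implyP := H (Ordinal lti); apply.
Qed.

Lemma homog_bounded k f : bounded_size (fun j =>
  \poly_(i < size f) (if (q * j == p * i + k)%N then f`_i else 0)).
Proof. by exists (size f) => j; exact: size_poly. Qed.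

(* The coefficients of [f] at the [i] with [q] not dividing [p i + k] are dropped. *)
Definition homog k f : diffop K := Diffop (homog_bounded k f).

Lemma dcf_homog k f i j :
  dcf (homog k f) i j = if (q * j == p * i + k)%N then f`_i else 0.
Proof.
rewrite dcfE coef_poly; case: ltnP => // /(nth_default 0) ->.
by rewrite if_same.
Qed.

Lemma coef_weight_part k L i : (weight_part k L)`_i =
  if (q %| p * i + k)%N then dcf L i ((p * i + k) %/ q)%N else 0.
Proof.
rewrite coef_poly; case: ltnP => // Li; case: ifP => // _; apply/esym/eqP.
by apply: contraTT Li => /dcf_dorder; rewrite -ltnNge.
Qed.

Lemma coef_weight_partE k L i j :
  (q * j = p * i + k)%N -> (weight_part k L)`_i = dcf L i j.
Proof. by move=> ijk; rewrite coef_weight_part -ijk dvdn_mulr // mulKn. Qed.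

Lemma weight_part_class k L : weight_part k L \in weight_class k.
Proof.
by apply/weight_classP => i; rewrite coef_weight_part; case: ifP; rewrite ?eqxx.
Qed.

Lemma size_weight_part k L : (size (weight_part k L) <= (dorder L).+1)%N.
Proof. exact: size_poly. Qed.

Lemma weight_partD k L M : weight_part k (L + M) = weight_part k L + weight_part k M.
Proof.
apply/polyP => i; rewrite coefD !coef_weight_part dcfD.
by case: ifP; rewrite ?addr0.
Qed.

Lemma weight_partN k L : weight_part k (- L) = - weight_part k L.
Proof.
apply/polyP => i; rewrite coefN !coef_weight_part dcfN.
by case: ifP; rewrite ?oppr0.
Qed.

Lemma weight_partB k L M : weight_part k (L - M) = weight_part k L - weight_part k M.
Proof. by rewrite weight_partD weight_partN. Qed.

Lemma weight_part_homog k f : f \in weight_class k -> weight_part k (homog k f) = f.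
Proof.
move=> /weight_classP fk; apply/polyP => i; rewrite coef_weight_part dcf_homog.
case: ifPn => [d|]; first by rewrite mulnC divnK ?eqxx.
by apply: contraNeq => ?; rewrite fk // eq_sym.
Qed.

Lemma weight_geW k l L : (l <= k)%N -> weight_ge k L -> weight_ge l L.
Proof.
by move=> lk Lk i j ij; apply: Lk; apply: leq_trans ij _; rewrite leq_add2l.
Qed.

Lemma weight_geD k L M : weight_ge k L -> weight_ge k M -> weight_ge k (L + M).
Proof. by move=> Lk Mk i j ij; rewrite dcfD Lk // Mk // addr0. Qed.

Lemma weight_geN k L : weight_ge k L -> weight_ge k (- L).
Proof. by move=> Lk i j ij; rewrite dcfN Lk // oppr0. Qed.

Lemma weight_geB k L M : weight_ge k L -> weight_ge k M -> weight_ge k (L - M).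
Proof. by move=> Lk Mk; apply: weight_geD => //; exact: weight_geN. Qed.

Lemma weight_ge_homog k f : weight_ge k (homog k f).
Proof. by move=> i j ij; rewrite dcf_homog ltn_eqF. Qed.

Lemma weight_geS k L : weight_ge k L -> weight_part k L = 0 -> weight_ge k.+1 L.
Proof.
move=> Lk L0 i j; rewrite addnS ltnS leq_eqVlt => /orP[/eqP ij|/Lk //].
by rewrite -(coef_weight_partE L ij) L0 coef0.
Qed.

Lemma weight_part_ge k L : weight_ge k.+1 L -> weight_part k L = 0.
Proof.
move=> Lk; apply/polyP => i; rewrite coef0 coef_weight_part.
by case: ifP => // d; apply: Lk; rewrite mulnC divnK //; lia.
Qed.

(** The term at [(i, j)] has weight at most [q j]. This separatedness turns congruences at all
    levels into an equality. *)
Lemma weight_ge_eq0 L : (forall k, weight_ge k L) -> L = 0.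
Proof.
by move=> H; apply: dcfP => i j; rewrite (H (q * j).+1) ?dcfE ?coef0 //; lia.
Qed.

(** The shift feeds degree [i] only from degrees [r >= i], whose terms with the same power of [t]
    have no larger weight. *)
Lemma coef_shiftp_weight_ge k L m i j :
  weight_ge k L -> (q * j < p * i + k)%N -> (shiftp m (L j))`_i = 0.
Proof.
move=> Lk ij; apply: nth_default; rewrite size_shiftpE.
apply/leq_sizeP => r ir; apply: (Lk r j); apply: leq_trans ij _.
by rewrite leq_add2r leq_mul2l ir orbT.
Qed.

Lemma weight_geM k l L M : weight_ge k L -> weight_ge l M -> weight_ge (k + l) (L * M).
Proof.
move=> Lk Ml i j ij; rewrite dcfE diffopM_coef coef_sum big1 // => u _.
rewrite coefM big1 // => r _.
have [h|h] := ltnP (q * u) (p * r + k).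
  by rewrite (coef_shiftp_weight_ge _ Lk h) mul0r.
have le_uj : (u <= j)%N by rewrite -ltnS.
have le_ri : (r <= i)%N by rewrite -ltnS.
have -> : (M (j - u)%N)`_(i - r) = 0; last by rewrite mulr0.
apply: Ml; rewrite !mulnBr.
by move: (leq_mul (leqnn q) le_uj) (leq_mul (leqnn p) le_ri); lia.
Qed.

(* [f(eps) t^m = t^m f(eps + m)] changes the leading part of [f] only when the
   slope is 0; otherwise the graded ring is commutative. *)
Definition twist k f := if p == 0%N then shiftp (k %/ q) f else f.

Lemma twist0 f : twist 0 f = f.
Proof. by rewrite /twist div0n shiftp0 if_same. Qed.

Lemma size_twist k f : size (twist k f) = size f.
Proof. by rewrite /twist; case: ifP => // _; exact: size_shiftpE. Qed.

Lemma twist_class k f : f \in weight_class 0 -> twist k f \in weight_class 0.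
Proof.
rewrite /twist; have [p0 _|//] := eqVneq p 0%N.
by apply/weight_classP => i _; rewrite p0 addn0 mul0n dvdn0.
Qed.

(** For [p = 0] the power of [t] alone fixes the weight, so the weight part is all of [L j] and is
    shifted by exactly [m]. For [p > 0] the bound on weights makes [i] at least the degree of [L j],
    and the shift does not change the coefficient there. *)
Lemma coef_twist_weight_part k l m L i j :
    weight_ge k L -> (q * j = p * i + k)%N -> (p = 0%N -> l = (q * m)%N) ->
  (twist l (weight_part k L))`_i = (shiftp m (L j))`_i.
Proof.
move=> Lk ij; rewrite /twist; have [p0 /(_ p0) ->|p0 _] := eqVneq p 0%N.
  rewrite mulKn //; congr ((shiftp _ _)`_i); apply/polyP => r.
  by rewrite (@coef_weight_partE k L r j) ?ij ?p0.
rewrite coef_shiftp_top ?(coef_weight_partE L ij) //.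
apply/leq_sizeP => r ir; apply: (Lk r j); rewrite ij ltn_add2r ltn_mul2l ir andbT.
by rewrite lt0n.
Qed.

(** A shift mixes degrees and might fill gaps, but it occurs only for [p = 0], when the divisibility
    does not depend on [i] and the whole weight part vanishes. *)
Lemma coef_twist_weight_part0 k l L i :
  ~~ (q %| p * i + k)%N -> (twist l (weight_part k L))`_i = 0.
Proof.
rewrite /twist; have [p0|p0 /negPf ik] := eqVneq p 0%N; last first.
  by rewrite coef_weight_part ik.
rewrite p0 => /negPf ik; have -> : weight_part k L = 0.
  by apply/polyP => r; rewrite coef_weight_part p0 ik coef0.
by rewrite /shiftp comp_poly0 coef0.
Qed.

(** Once the degree [i] is split as [r + (i - r)], at most one splitting of the power of [t] gives
    the factors weights exactly [k] and [l]. Any other splitting puts one factor below its bound and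
    contributes nothing. *)
Lemma weight_partM k l L M : weight_ge k L -> weight_ge l M ->
  weight_part (k + l) (L * M) = twist l (weight_part k L) * weight_part l M.
Proof.
move=> Lk Ml; apply/polyP => i; rewrite coefM coef_weight_part.
have split_i (r : 'I_i.+1) : (p * i + (k + l) = (p * r + k) + (p * (i - r) + l))%N.
  by rewrite mulnBr; have := leq_mul (leqnn p) (leq_ord r); lia.
case: ifPn => [/dvdnP[j ij]|ndvd]; last first.
  rewrite big1 // => r _; have [rk|?] := boolP (q %| p * r + k)%N; last first.
    by rewrite coef_twist_weight_part0 ?mul0r.
  move: ndvd; rewrite (split_i r) dvdn_addr // => /negPf ndvd.
  by rewrite [(weight_part l M)`__]coef_weight_part ndvd mulr0.
rewrite ij mulnK // dcfE diffopM_coef coef_sum.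
under eq_bigr do rewrite coefM.
rewrite exchange_big; apply: eq_bigr => r _ /=.
move: (split_i r); rewrite ij mulnC => split_j.
have term0 (u : 'I_j.+1) : (q * u != p * r + k)%N ->
    (shiftp (j - u) (L u))`_r * (M (j - u)%N)`_(i - r) = 0.
  rewrite neq_ltn => /orP[h|h].
    by rewrite (coef_shiftp_weight_ge _ Lk h) mul0r.
  have -> : (M (j - u)%N)`_(i - r) = 0; last by rewrite mulr0.
  apply: Ml; rewrite mulnBr.
  by have := leq_mul (leqnn q) (leq_ord u); lia.
(* If [q] does not divide [p r + k], every [u] contributes zero and, the total being a multiple of
   [q], so does the right-hand term. Otherwise only [u = v] survives. *)
have [/dvdnP[v rk]|ndvd] := boolP (q %| p * r + k)%N; last first.
  rewrite big1 => [|u _]; last first.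
    by apply: term0; apply: contraNneq ndvd => <-; exact: dvdn_mulr.
  rewrite [(weight_part l M)`__]coef_weight_part ifN ?mulr0 //.
  by apply: contraNN ndvd => d; rewrite -(dvdn_addl _ d) -split_j dvdn_mulr.
rewrite (mulnC v) in rk.
have ltvj : (v < j.+1)%N by rewrite ltnS -(leq_pmul2l q_gt0) -rk split_j leq_addr.
have jv : (q * (j - v) = p * (i - r) + l)%N by rewrite mulnBr -rk split_j addKn.
rewrite (bigD1 (Ordinal ltvj)) //= big1 ?addr0 => [|u uv]; last first.
  apply: term0; apply: contraNneq uv; rewrite rk => /eqP.
  by rewrite eqn_pmul2l.
rewrite (coef_weight_partE M jv).
rewrite (coef_twist_weight_part (m := (j - v)%N) Lk (esym rk)) // => p0.
by rewrite jv p0.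
Qed.

End Weight.

(** * Lifting a factorization of the leading part *)

(** With [u a + v b = 1], one takes for [y] the remainder of [r u] modulo [b]. The bound on [x] is
    then read off from [x b = r - a y], where both terms have size at most [m + size b]. *)
Lemma bezout_bounded (K : fieldType) (a b r : {poly K}) m :
    coprimep a b -> b != 0 -> (size a <= m.+1)%N -> (size r <= m + size b)%N ->
  exists x y, [/\ r = a * y + x * b, (size y < size b)%N & (size x <= m.+1)%N].
Proof.
move=> /Bezout_eq1_coprimepP[[u v] /= uv] b0 sa sr.
have [y_lt y_def] : (size ((r * u) %% b)%R < size b)%N /\
    r * u = (r * u) %/ b * b + (r * u) %% b.
  by split; [rewrite ltn_modp | exact: divp_eq].
move: (_ %% b) (_ %/ b) y_lt y_def => y c y_lt y_def.
have def_r : r = a * y + (a * c + r * v) * b.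
  transitivity ((r * u) * a + r * v * b); first by rewrite -{1}[r]mulr1 -uv; ring.
  by rewrite y_def; ring.
exists (a * c + r * v), y; split=> //.
have [->|x0] := eqVneq (a * c + r * v) 0; first by rewrite size_poly0.
have : (size ((a * c + r * v) * b)%R <= m + size b)%N.
  have -> : (a * c + r * v) * b = r - a * y.
    by rewrite [X in X - _]def_r addrAC subrr add0r.
  apply: leq_trans (size_polyD _ _) _; rewrite geq_max sr size_polyN /=.
  apply: leq_trans (size_polyMleq _ _) _.
  by move: (size a) (size y) (size b) sa y_lt => i j k; lia.
rewrite size_mul //; move: b0; rewrite -size_poly_gt0.
by move: (size _) (size b) => i j; lia.
Qed.

Section Hensel.
Variables (K : fieldType) (p q : nat).
Hypothesis q_gt0 : (0 < q)%N.
Implicit Types (L M : diffop K) (f g : {poly K}).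

Lemma size_homog k f j : (size (homog p q k f j) <= size f)%N.
Proof. exact: size_poly. Qed.

Lemma coef_weight_part_homog k f i : (weight_part p q k (homog p q k f))`_i =
  if (q %| p * i + k)%N then f`_i else 0.
Proof.
rewrite coef_weight_part dcf_homog; case: ifP => // d.
by rewrite mulnC divnK ?eqxx.
Qed.

Lemma weight_part_homogD k f g : weight_part p q k (homog p q k (f + g)) =
  weight_part p q k (homog p q k f) + weight_part p q k (homog p q k g).
Proof.
apply/polyP => i; rewrite coefD !coef_weight_part_homog coefD.
by case: ifP; rewrite ?addr0.
Qed.

(** Applying [homog] and then [weight_part] projects onto [weight_class k]. A factor of class 0 does
    not change divisibility by [q], so the projection is linear over such factors; Bezout solutions
    with stray terms can therefore be projected. *)
Lemma weight_part_homogM k f g : f \in weight_class p q 0 ->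
  weight_part p q k (homog p q k (f * g)) = f * weight_part p q k (homog p q k g).
Proof.
move=> /weight_classP f0; apply/polyP => i; rewrite coef_weight_part_homog !coefM.
transitivity (\sum_(r < i.+1)
    if (q %| p * i + k)%N then f`_r * g`_(i - r) else 0).
  by case: ifP => // _; rewrite big1.
apply: eq_bigr => r _; rewrite coef_weight_part_homog.
have [->|/f0] := eqVneq f`_r 0; first by rewrite !mul0r if_same.
rewrite addn0 => d; have -> : (p * i + k = p * r + (p * (i - r) + k))%N.
  by rewrite mulnBr; have := leq_mul (leqnn p) (leq_ord r); lia.
by rewrite dvdn_addr //; case: ifP; rewrite ?mulr0.
Qed.

Lemma weight_limit (u : nat -> diffop K) b :
    (forall k, weight_ge p q k.+1 (u k.+1 - u k)) ->
    (forall k (j : nat), (size (u k j) <= b)%N) ->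
  exists U : diffop K, (forall k, weight_ge p q k.+1 (U - u k)) /\
    forall j : nat, (size (U j) <= b)%N.
Proof.
(* The coefficient of [t^j] is read at stage [q j]: later corrections have weight above [q j] and
   reach no term [t^j eps^i]. *)
move=> du ub; have Ub : bounded_size (fun j => u (q * j)%N j) by exists b.
exists (Diffop Ub); split=> [k i j ij|j]; last exact: ub.
have stab m l : (q * j < p * i + m.+1)%N -> dcf (u (l + m)%N) i j = dcf (u m) i j.
  move=> ijm; elim: l => // l <-; apply/eqP.
  by rewrite addSn -subr_eq0 -dcfB du //; lia.
rewrite dcfB dcfE /= -dcfE -(stab k (q * j)%N ij) addnC stab ?subrr //; lia.
Qed.

Section Factor.
Variables (L : diffop K) (A0 B0 : {poly K}).
Hypothesis L_ge0 : weight_ge p q 0 L.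
Hypothesis L_part : weight_part p q 0 L = A0 * B0.
Hypotheses (A0_neq0 : A0 != 0) (B0_neq0 : B0 != 0).
Hypotheses (A0_class : A0 \in weight_class p q 0) (B0_class : B0 \in weight_class p q 0).
Hypothesis coprimeAB : forall k, (0 < k)%N -> coprimep (twist p q k A0) B0.

Let d := (size B0).-1.
Let m := (dorder L - d)%N.

(** The leading parts stay fixed while the error moves up in weight. The size bounds are independent
    of [k], so the limits are operators whose order bounds add up to the order of [L]. *)
Definition approx_factors k (AB : diffop K * diffop K) :=
  [/\ weight_ge p q 1 (AB.1 - homog p q 0 A0),
      weight_ge p q 1 (AB.2 - homog p q 0 B0),
      weight_ge p q k (L - AB.1 * AB.2),
      forall j : nat, (size (AB.1 j) <= m.+1)%N
    & forall j : nat, (size (AB.2 j) <= d.+1)%N].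

Let size_B0 : size B0 = d.+1.
Proof. by rewrite prednK // size_poly_gt0. Qed.

Let size_A0 : (size A0 + d <= (dorder L).+1)%N.
Proof.
have := size_weight_part p q 0 L; rewrite L_part size_mul // size_B0.
by rewrite addnS.
Qed.

Let dorder_split : (m + d = dorder L)%N.
Proof. by move: A0_neq0 size_A0; rewrite /m -size_poly_gt0; lia. Qed.

Lemma weight_approx f M : f \in weight_class p q 0 ->
  weight_ge p q 1 (M - homog p q 0 f) ->
  weight_ge p q 0 M /\ weight_part p q 0 M = f.
Proof.
move=> f0 Mf; rewrite -[M](subrK (homog p q 0 f)); split.
  by apply: weight_geD; [exact: weight_geW Mf | exact: weight_ge_homog].
by rewrite weight_partD (weight_part_ge q_gt0 Mf) add0r weight_part_homog.
Qed.

Lemma approx_factors0 : approx_factors 1 (homog p q 0 A0, homog p q 0 B0).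
Proof.
split=> /=; try by rewrite subrr => i j _; rewrite dcfE coef0.
- apply: (weight_geS q_gt0).
    apply: weight_geB => //; rewrite -[0%N]addn0.
    by apply: (weight_geM q_gt0); exact: weight_ge_homog.
  rewrite weight_partB L_part -[0%N]addn0 weight_partM ?twist0 //;
    try exact: weight_ge_homog.
  by rewrite addn0 !weight_part_homog // subrr.
- by move=> j; apply: leq_trans (size_homog _ _ _) _; move: size_A0; lia.
- by move=> j; rewrite -size_B0; exact: size_homog.
Qed.

(** Corrections [x] of [A] and [y] of [B], homogeneous of weight [k], change the weight [k] part of
    the product by [twist_k(A0) y + x B0], which is solved to cancel the error there. *)
Lemma approx_factors_step k AB : (0 < k)%N -> approx_factors k AB ->
  exists AB', [/\ approx_factors k.+1 AB',
    weight_ge p q k (AB'.1 - AB.1) & weight_ge p q k (AB'.2 - AB.2)].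
Proof.
case: AB => A B k_gt0 [/= A_approx B_approx AB_ge sA sB].
have [A_ge A_part] := weight_approx A0_class A_approx.
have [B_ge B_part] := weight_approx B0_class B_approx.
pose r := weight_part p q k (L - A * B).
have sr : (size r <= m + size B0)%N.
  apply: leq_trans (size_weight_part _ _ _ _) _; rewrite size_B0 addnS ltnS.
  apply: dorder_leq => j; apply: leq_trans (size_polyD _ _) _.
  rewrite size_polyN geq_max; apply/andP; split; last exact: size_diffopM.
  by rewrite dorder_split; exact: size_dorder.
have sA0 : (size (twist p q k A0) <= m.+1)%N.
  by rewrite size_twist; move: size_A0; rewrite -dorder_split; lia.
have [x [y [rxy sy sx]]] := bezout_bounded (coprimeAB k_gt0) B0_neq0 sA0 sr.
have X_ge := weight_ge_homog (p := p) (q := q) (k := k) x.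
have Y_ge := weight_ge_homog (p := p) (q := q) (k := k) y.
exists (A + homog p q k x, B + homog p q k y) => /=.
rewrite !(addrAC _ (homog p q k _)) !subrr !add0r; split=> //; split=> /=.
- by rewrite addrAC; apply: weight_geD => //; exact: weight_geW X_ge.
- by rewrite addrAC; apply: weight_geD => //; exact: weight_geW Y_ge.
- have AY_ge : weight_ge p q k (A * homog p q k y).
    exact: (weight_geM q_gt0 A_ge Y_ge).
  have XB_ge : weight_ge p q k (homog p q k x * B).
    by rewrite -[X in weight_ge _ _ X]addn0; exact: (weight_geM q_gt0).
  have -> : L - (A + homog p q k x) * (B + homog p q k y) =
     (L - A * B - (A * homog p q k y + homog p q k x * B))
       - homog p q k x * homog p q k y.
    by rewrite mulrDl !mulrDr !opprD !addrA.
  apply: weight_geB; last first.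
    (* The product of the two corrections has weight at least [2 k], hence at least [k + 1] since
       [k > 0]. *)
    by apply: weight_geW (weight_geM q_gt0 X_ge Y_ge); lia.
  apply: (weight_geS q_gt0); first by apply: weight_geB => //; exact: weight_geD.
  rewrite weight_partB [X in _ - X]weight_partD.
  have -> : weight_part p q k (A * homog p q k y) =
      twist p q k A0 * weight_part p q k (homog p q k y).
    by rewrite -[X in weight_part _ _ X (A * _)]add0n weight_partM // A_part.
  have -> : weight_part p q k (homog p q k x * B) =
      weight_part p q k (homog p q k x) * B0.
    by rewrite -[X in weight_part _ _ X (_ * B)]addn0 weight_partM ?twist0 // B_part.
  (* The projection onto class [k] is pulled out of the sum; it fixes [r], which is itself a weight
     [k] part. *)
  rewrite [_ * B0]mulrC -!weight_part_homogM // ?twist_class //.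
  rewrite -weight_part_homogD (mulrC B0) -rxy weight_part_homog ?subrr //.
  exact: weight_part_class.
- move=> j; apply: leq_trans (size_polyD _ _) _.
  by rewrite geq_max sA (leq_trans (size_homog _ _ _)).
- move=> j; apply: leq_trans (size_polyD _ _) _.
  by rewrite geq_max sB (leq_trans (size_homog _ _ _)) // -size_B0 ltnW.
Qed.

Lemma weight_part_factor : exists A B : diffop K,
  [/\ L = A * B, (dorder A <= dorder L - d)%N & (dorder B <= d)%N].
Proof.
(* Keeping the hypothesis inside the relation lets [choice] produce a total function. Index [k]
   stands for accuracy [k + 1], since weight 0 is settled at the start. *)
pose step kAB AB' := approx_factors kAB.1.+1 kAB.2 ->
  [/\ approx_factors kAB.1.+2 AB', weight_ge p q kAB.1.+1 (AB'.1 - kAB.2.1)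
    & weight_ge p q kAB.1.+1 (AB'.2 - kAB.2.2)].
have [next nextP] : {next & forall kAB, step kAB (next kAB)}.
  apply: choice => -[k AB]; have [kAB|nkAB] := pselect (approx_factors k.+1 AB).
    by have [AB' ?] := approx_factors_step (ltn0Sn k) kAB; exists AB'.
  by exists AB => /nkAB.
pose fix u k := if k is k'.+1 then next (k', u k')
                else (homog p q 0 A0, homog p q 0 B0).
have u_approx k : approx_factors k.+1 (u k).
  by elim: k => [|k /(nextP (k, _))[]//]; exact: approx_factors0.
have du k := nextP (k, u k) (u_approx k).
have [A [Au sA]] : exists A, (forall k, weight_ge p q k.+1 (A - (u k).1)) /\
    forall j : nat, (size (A j) <= m.+1)%N.
  apply: (weight_limit (u := fun k => (u k).1)) => k; last by case: (u_approx k).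
  by case: (du k).
have [B [Bu sB]] : exists B, (forall k, weight_ge p q k.+1 (B - (u k).2)) /\
    forall j : nat, (size (B j) <= d.+1)%N.
  apply: (weight_limit (u := fun k => (u k).2)) => k; last by case: (u_approx k).
  by case: (du k).
exists A, B; split; [|exact: dorder_leq..].
apply/eqP; rewrite -subr_eq0; apply/eqP/(weight_ge_eq0 q_gt0) => k.
have [A_approx B_approx AB_ge _ _] := u_approx k.
have [uB_ge _] := weight_approx B0_class B_approx.
have [uA_ge _] := weight_approx A0_class A_approx.
have A_ge : weight_ge p q 0 A.
  rewrite -[A](subrK (u k).1); apply: weight_geD => //.
  exact: weight_geW (Au k).
(* Telescoping: each of the three terms has weight at least [k], for every [k]. *)
have -> : L - A * B = (L - (u k).1 * (u k).2)
    - ((A - (u k).1) * (u k).2 + A * (B - (u k).2)).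
  rewrite mulrBl mulrBr (addrC (_ - _) (A * B - _)) (addrA (A * B - _)) subrK.
  by rewrite opprB addrA subrK.
apply: weight_geB; first exact: weight_geW AB_ge.
apply: weight_geD.
  rewrite -[X in weight_ge _ _ X]addn0; apply: (weight_geM q_gt0) => //.
  exact: weight_geW (Au k).
by apply: (weight_geM q_gt0 A_ge); exact: weight_geW (Bu k).
Qed.

End Factor.
End Hensel.

(** * Newton polygons with one slope *)

Section NewtonPolygonSlope.
Variable R : realType.
Local Open Scope classical_set_scope.

Lemma convex_planeP (A : set (R^o * R^o)) :
  convex_set (A : set (convex_lmodType (R^o * R^o)%type)) <->
  forall (x y : R^o * R^o) (t : R), 0 <= t -> t <= 1 -> A x -> A y ->
    A (t * x.1 + (1 - t) * y.1, t * x.2 + (1 - t) * y.2).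
Proof.
split=> [cA x y t t0 t1 Ax Ay|cA x y t xA yA].
  have := cA x y (Itv01 t0 t1); rewrite !inE => /(_ Ax Ay); congr A.
move: xA yA; rewrite !inE => Ax Ay.
have := cA x y t%:num _ _ Ax Ay; apply; first exact: ge0.
exact: le1.
Qed.

Lemma closed_epigraph (n : nat) (rho : R) : closed (epigraph n (fun x => rho * x)).
Proof.
have c1 : continuous (fst : R^o * R^o -> R^o) by move=> z; exact: cvg_fst.
have c2 : continuous (snd : R^o * R^o -> R^o) by move=> z; exact: cvg_snd.
have -> : epigraph n (fun x => rho * x) =
  (fst @^-1` [set x : R^o | 0 <= x]) `&` (fst @^-1` [set x : R^o | x <= n%:R])
   `&` ((fun z : R^o * R^o => z.2 - rho * z.1) @^-1` [set x : R^o | 0 <= x]).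
  by apply/seteqP; split=> z; rewrite /epigraph /= subr_ge0;
    [case=> /andP[-> ->] -> | case=> -[-> ->] ->].
apply: closedI; first apply: closedI.
- by apply: preimage_closed => [z _|]; [exact: c1 | exact: closed_ge].
- by apply: preimage_closed => [z _|]; [exact: c1 | exact: closed_le].
- apply: preimage_closed => [z _|]; last exact: closed_ge.
  apply: (@continuousB _ R^o); first exact: c2.
  by apply: (@continuousM _ _ (fun=> rho) fst); [exact: cvg_cst | exact: c1].
Qed.

(** The epigraph is itself one of the sets being intersected. Conversely, every such set contains
    the origin and the end vertex, hence the segment joining them and all that lies above it. *)
Lemma newton_polygon_slope (L : diffop R[i]) (rho : R) :
    0 <= rho ->
    (forall i j, dcf L i j != 0 -> rho * i%:R <= j%:R) ->
    (exists j, dcf L (dorder L) j != 0 /\ j%:R = rho * (dorder L)%:R) ->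
  newton_polygon L = epigraph (dorder L) (fun x => rho * x).
Proof.
move=> rho0 Lge [j0 [Lj0 Ej0]]; apply/seteqP; split=> [z|[x y] /=].
  apply; split; first split.
  - exact: closed_epigraph.
  - apply/convex_planeP => u v t t0 t1 [/andP[u0 un] ru] [/andP[v0 vn] rv].
    split=> /=; last by nra.
    by apply/andP; split; nra.
  - by move=> u v [/= uv ruv]; split=> //=; lra.
  - move=> _ [->|[i [j [Lij ->]]]]; split=> /=.
    + by rewrite lexx ler0n.
    + by rewrite mulr0.
    + by rewrite ler0n ler_nat (dcf_dorder Lij).
    + exact: Lge.
move=> [/= /andP[x0 xn] xy] A [[_ /convex_planeP cA uA] GA].
have A0 : A (0, 0) by apply: GA; left.
have An : A ((dorder L)%:R, rho * (dorder L)%:R).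
  by apply: GA; right; exists (dorder L), j0; rewrite Ej0.
have Ax : A (x, rho * x).
  have [n0|n_gt0] := posnP (dorder L).
    have -> : x = 0 by apply/le_anti; rewrite x0 andbT; move: xn; rewrite n0.
    by rewrite mulr0.
  have npos : 0 < (dorder L)%:R :> R by rewrite ltr0n.
  have := cA _ _ (x / (dorder L)%:R) _ _ An A0 => /=.
  have -> : x / (dorder L)%:R * (dorder L)%:R + (1 - x / (dorder L)%:R) * 0 = x.
    by field; rewrite gt_eqF.
  have -> : x / (dorder L)%:R * (rho * (dorder L)%:R) +
      (1 - x / (dorder L)%:R) * 0 = rho * x.
    by field; rewrite gt_eqF.
  apply; first by rewrite divr_ge0 // ltW.
  by rewrite ler_pdivrMr // mul1r.
(* Invariance gives only integer translates; a convex combination with a high enough one reaches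
   [y]. *)
have up (k : nat) : A (x, rho * x + k%:R).
  elim: k => [|k IH]; first by rewrite addr0.
  by rewrite -natr1 addrA; exact: uA.
have [k ky] : exists k : nat, y - rho * x < k%:R.
  by exists (Num.truncn (y - rho * x)).+1; rewrite truncnS_gt.
have k0 : 0 < k%:R :> R by apply: le_lt_trans ky; rewrite subr_ge0.
have := cA _ _ ((y - rho * x) / k%:R) _ _ (up k) Ax => /=.
have -> : (y - rho * x) / k%:R * x + (1 - (y - rho * x) / k%:R) * x = x by ring.
have -> : (y - rho * x) / k%:R * (rho * x + k%:R)
   + (1 - (y - rho * x) / k%:R) * (rho * x) = y.
  by field; rewrite gt_eqF.
apply; first by rewrite divr_ge0 ?subr_ge0 // ltW.
by rewrite ler_pdivrMr // mul1r ltW.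
Qed.

End NewtonPolygonSlope.

(** * The smallest slope of an operator *)

(** A term of smallest slope [j0 / i0] has weight 0 and no term has negative weight. Since [i0 > 0],
    the weight 0 part is not constant. *)
Lemma newton_slope_exists (K : fieldType) (L : diffop K) : (0 < dorder L)%N ->
  exists p q, [/\ (0 < q)%N, coprime p q, weight_ge p q 0 L &
    (1 < size (weight_part p q 0 L))%N].
Proof.
move=> /dorder_gt_dcf[i1 [j1 [i1_gt0 Lij1]]]; set n := dorder L.
(* [j * (n! / i)] is an integer multiple of the slope [j / i]. *)
pose slopes v := exists i j, [/\ (0 < i)%N, dcf L i j != 0 & v = (j * (n`! %/ i))%N].
have ex_slope : exists v, `[< slopes v >].
  by exists (j1 * (n`! %/ i1))%N; apply/asboolP; exists i1, j1.
case: (ex_minnP ex_slope) => _ /asboolP[i0 [j0 [i0_gt0 Lij0 ->]]] slope_min.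
have dvd_fact i j : (0 < i)%N -> dcf L i j != 0 -> (n`! %/ i * i = n`!)%N.
  by move=> i_gt0 Lij; rewrite divnK // dvdn_fact // i_gt0; exact: dcf_dorder Lij.
have slope_le i j : dcf L i j != 0 -> (j0 * i <= j * i0)%N.
  have [->|i_gt0] := posnP i; first by rewrite muln0.
  move=> Lij; have /slope_min : `[< slopes (j * (n`! %/ i))%N >].
    by apply/asboolP; exists i, j.
  rewrite -(leq_pmul2r (_ : 0 < i * i0)%N) ?muln_gt0 ?i_gt0 //.
  have -> : (j0 * (n`! %/ i0) * (i * i0) = n`! * (j0 * i))%N.
    rewrite -{2}(dvd_fact _ _ i0_gt0 Lij0); ring.
  have -> : (j * (n`! %/ i) * (i * i0) = n`! * (j * i0))%N.
    rewrite -{2}(dvd_fact _ _ i_gt0 Lij); ring.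
  by rewrite leq_pmul2l // fact_gt0.
set g := gcdn j0 i0; have g_gt0 : (0 < g)%N by rewrite gcdn_gt0 i0_gt0 orbT.
pose p := (j0 %/ g)%N; pose q := (i0 %/ g)%N.
have Ej0 : j0 = (p * g)%N by rewrite divnK // dvdn_gcdl.
have Ei0 : i0 = (q * g)%N by rewrite divnK // dvdn_gcdr.
have q_gt0 : (0 < q)%N by move: i0_gt0; rewrite Ei0 muln_gt0 => /andP[].
exists p, q; split=> //.
- by rewrite /coprime -(eqn_pmul2r g_gt0) mul1n muln_gcdl -Ej0 -Ei0.
- move=> i j; rewrite addn0; apply: contraTeq => /slope_le; rewrite -leqNgt.
  rewrite Ej0 Ei0 mulnAC mulnA leq_pmul2r // => /leq_trans; apply.
  by rewrite mulnC.
- rewrite ltnNge; apply/negP => /leq_sizeP/(_ i0 i0_gt0)/eqP.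
  have E : (q * j0 = p * i0 + 0)%N by rewrite Ei0 Ej0; ring.
  by rewrite (coef_weight_partE q_gt0 L E) (negPf Lij0).
Qed.

(** * Leading parts and characteristic polynomials *)

Section Homogenisation.
Variables (K : comNzRingType) (p q : nat).
Hypotheses (q_gt0 : (0 < q)%N) (coprime_pq : coprime p q).

(** Reinstates [t]: if the weight 0 part is [f(xi^q)] at [t = 1], this is the leading part in [t]
    and [xi]. *)
Definition homogenise (f : {poly K}) : {poly {poly K}} :=
  (map_poly (polyC \o polyC) f).[('X^p)%:P * 'X^q].

Lemma coef_homogenise f i j : (homogenise f)`_i`_j =
  if (q * j == p * i)%N then (f \Po 'X^q)`_i else 0.
Proof.
have coefE m : ((f`_m)%:P%:P * (('X^p)%:P * 'X^q) ^+ m)`_i`_j =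
    if (i == q * m)%N && (j == p * m)%N then f`_m else 0.
  rewrite exprMn -polyC_exp -!exprM !coefCM coefXn.
  case: eqVneq => _ /=; last by rewrite mulr0 coef0 mulr0.
  by rewrite mulr1 coefXn; case: eqVneq; rewrite ?mulr1 ?mulr0.
have -> : (homogenise f)`_i`_j = \sum_(m < size f)
    if (i == q * m)%N && (j == p * m)%N then f`_m else 0.
  rewrite /homogenise (@horner_coef_wide _ (size f)) ?size_poly // !coef_sum.
  by apply: eq_bigr => m _; rewrite coef_map coefE.
rewrite coef_comp_poly_Xn //; case: eqVneq => [qj|qj]; last first.
  rewrite big1 // => m _; case: andP => // -[/eqP im /eqP jm].
  by case/eqP: qj; rewrite im jm; ring.
(* Coprimality forces [(i, j)] to be a multiple of [(q, p)], so one power of [t^p xi^q]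
   contributes. *)
have /dvdnP[m im] : (q %| i)%N.
  by rewrite -(Gauss_dvdr _ (_ : coprime q p)) 1?coprime_sym // -qj dvdn_mulr.
have jm : j = (p * m)%N.
  by apply/eqP; rewrite -(eqn_pmul2l q_gt0) qj im; apply/eqP; ring.
rewrite im dvdn_mull // mulnK //.
have [m_lt|m_ge] := ltnP m (size f); last first.
  rewrite nth_default // big1 // => r _; case: andP => // -[/eqP mr _].
  have := ltn_ord r; rewrite ltnNge; move: mr; rewrite mulnC => /eqP.
  by rewrite eqn_pmul2l // => /eqP <-; rewrite m_ge.
rewrite (bigD1 (Ordinal m_lt)) //= jm eqxx mulnC eqxx /= big1 ?addr0 // => r.
move=> r_neq; case: andP => // -[/eqP mr _]; case/eqP: r_neq.
by apply/val_inj; apply/eqP; rewrite -(eqn_pmul2l q_gt0) mr.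
Qed.

Lemma homogeniseM f g : homogenise (f * g) = homogenise f * homogenise g.
Proof. by rewrite /homogenise rmorphM hornerM. Qed.

Lemma homogeniseC c : homogenise c%:P = c%:P%:P.
Proof. by rewrite /homogenise map_polyC hornerC. Qed.

Lemma homogeniseXn m : homogenise 'X^m = ('X^(p * m))%:P * 'X^(q * m).
Proof.
by rewrite /homogenise map_polyXn hornerXn exprMn -polyC_exp -!exprM.
Qed.

Lemma homogenise_linear c : homogenise (c%:P - 'X) = c%:P%:P - ('X^p)%:P * 'X^q.
Proof.
by rewrite /homogenise rmorphB /= map_polyC map_polyX hornerD hornerN hornerC hornerX.
Qed.

Lemma homogenise_prod_linear (s : seq K) :
  homogenise (\prod_(z <- s) (z%:P - 'X)) =
  \prod_(z <- s) (z%:P%:P - ('X^p)%:P * 'X^q).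
Proof.
rewrite (big_morph homogenise homogeniseM (homogeniseC 1)).
by apply: eq_bigr => z _; exact: homogenise_linear.
Qed.

End Homogenisation.

(** Zero roots are collected in ['X^m]; each other factor ['X - z] is reversed at the cost of a sign
    in [c]. *)
Lemma closed_poly_normal (K : closedFieldType) (f : {poly K}) : f != 0 ->
  exists c m (s : seq K), [/\ c != 0, 0 \notin s &
    f = c%:P * 'X^m * \prod_(z <- s) (z%:P - 'X)].
Proof.
move=> f0; have [r ->] := closed_field_poly_normal f.
move: (lead_coef f) (lead_coef_eq0 f); rewrite (negPf f0) => c /negbT.
elim: r => [|z r IH] c0.
  exists c, 0%N, [::]; split=> //; by rewrite !big_nil expr0 -mul_polyC mulr1.
have [c' [m [s [c'0 s0 E]]]] := IH c0.
rewrite big_cons scalerAr E; have [->|z0] := eqVneq z 0.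
  by exists c', m.+1, s; split=> //; rewrite exprS subr0; ring.
exists (- c'), m, (z :: s); split; rewrite ?oppr_eq0 //.
  by rewrite inE negb_or eq_sym z0.
by rewrite big_cons polyCN; ring.
Qed.

Lemma root_prod_subX (K : idomainType) (s : seq K) a :
  root (\prod_(z <- s) (z%:P - 'X)) a -> a \in s.
Proof.
rewrite rootE horner_prod prodf_seq_eq0 => /hasP[z zs] /=.
by rewrite !hornerE subr_eq0 => /eqP <-.
Qed.

(** The weight 0 part reaches [xi^n], with [n] the order, so its terms lie on the whole lower edge
    of the polygon. Only nonzero roots of [f] matter: the root 0 goes into the monomial factor of
    the leading part. *)
Lemma monic_op_slope (R : realType) (L : diffop R[i]) p q (f : {poly R[i]}) (l : R[i]) :
    (0 < q)%N -> coprime p q -> (0 < dorder L)%N -> weight_ge p q 0 L ->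
    size (weight_part p q 0 L) = (dorder L).+1 -> weight_part p q 0 L = f \Po 'X^q ->
    (forall a, root f a -> a != 0 -> a = l) -> monic_op L.
Proof.
move=> q_gt0 coprime_pq L_gt0 L_ge sL Lf fl.
pose rho : rat := p%:~R / q%:~R; exists rho.
have rho_num : numq rho = p.
  by rewrite coprimeq_num // gtr0_sg ?mul1r // ltz_nat.
have rho_den : denq rho = q.
  by rewrite coprimeq_den // -[X in if X then _ else _]/(q == 0%N) gtn_eqF.
have Lij_ge i j : dcf L i j != 0 -> (p * i <= q * j)%N.
  by apply: contraNleq => ij; apply/eqP/L_ge; rewrite addn0.
have [j0 [Ej0 Lj0]] : exists j0, (q * j0 = p * dorder L)%N /\ dcf L (dorder L) j0 != 0.
  have : (weight_part p q 0 L)`_(dorder L) != 0.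
    rewrite -[dorder L]/(dorder L).+1.-1 -sL -lead_coefE lead_coef_eq0.
    by rewrite -size_poly_gt0 sL.
  rewrite coef_weight_part addn0; case: ifP; rewrite ?eqxx // => d Ld.
  by exists (p * dorder L %/ q)%N; rewrite mulnC divnK.
have f0 : f != 0.
  by apply: contra_eq_neq sL => f0; rewrite Lf f0 comp_poly0 size_poly0.
have [c [m [s [c0 s0 Ef]]]] := closed_poly_normal f0.
exists (c%:P * \prod_(z <- s) (z%:P - 'X)); split; last first.
- exists l => a; rewrite rootM rootC (negPf c0) /= => ra; apply: fl.
    by rewrite Ef rootM ra orbT.
  by apply: contraNneq s0 => <-; exact: root_prod_subX.
- have weightE i j : weight rho i j = ((q * j)%:R - (p * i)%:R) / q%:R.
    by rewrite /weight /rho !natrM; field; rewrite pnatr_eq0 -lt0n.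
  have qR : 0 < q%:R^-1 :> rat by rewrite invr_gt0 ltr0n.
  (* The minimal weight is 0, attained at the end vertex [(dorder L, j0)]. *)
  have minimalP i j : minimal_term L rho i j <-> dcf L i j != 0 /\ (q * j = p * i)%N.
    split=> [[Lij ij_min]|[Lij ij]]; split=> //.
      apply/eqP; rewrite eqn_leq Lij_ge // andbT.
      have := ij_min _ _ Lj0; rewrite !weightE Ej0 subrr mul0r.
      by rewrite pmulr_lle0 // subr_le0 ler_nat.
    move=> i' j' Lij'; rewrite !weightE ij subrr mul0r pmulr_lge0 // subr_ge0.
    by rewrite ler_nat Lij_ge.
  exists (homogenise p q f), c, (q * m)%N, (p * m)%N, s.
  rewrite rho_num rho_den !absz_nat; split=> //; last first.
    rewrite Ef !homogeniseM homogeniseC homogeniseXn mulrA; congr (_ * _).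
    exact: homogenise_prod_linear.
  have coefP i j : (homogenise p q f)`_i`_j = if (q * j == p * i)%N then dcf L i j else 0.
    rewrite coef_homogenise // -Lf; case: eqP => // ij.
    by apply: coef_weight_partE => //; rewrite addn0.
  split=> i j; first by move=> /minimalP[_ ij]; rewrite coefP ij eqxx.
  move=> ij_min; rewrite coefP; case: eqP => // ij; apply/eqP.
  by apply: contraT => Lij; case: ij_min; apply/minimalP.
- have qR : 0 < q%:R :> R by rewrite ltr0n.
  have ratr_rho : ratr rho = p%:R / q%:R :> R by rewrite /rho fmorph_div /= !ratr_int.
  split=> //; first by rewrite divr_ge0 // ler0z.
  rewrite ratr_rho; apply: newton_polygon_slope.
  + by rewrite divr_ge0 ?ler0n.
  + move=> i j /Lij_ge; rewrite mulrAC ler_pdivrMr // -!natrM ler_nat.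
    by rewrite (mulnC j).
  + exists j0; split=> //; apply: (mulfI (lt0r_neq0 qR)).
    by rewrite -natrM Ej0 natrM; field; rewrite gt_eqF.
Qed.

(** * Splitting an operator that is not monic *)

(** Otherwise each root has another one a positive integer above it, and the resulting increasing
    chain exceeds the degree. *)
Lemma maximal_root (K : numDomainType) (f : {poly K}) a : f != 0 -> root f a ->
  exists x, root f x /\ forall k, (0 < k)%N -> ~~ root f (x + k%:R).
Proof.
move=> f0 fa; apply: contrapT => no_max.
have next x : root f x -> exists k, (0 < k)%N /\ root f (x + k%:R).
  move=> fx; apply: contrapT => no_next; apply: no_max; exists x; split=> // k k_gt0.
  by apply/negP => fk; apply: no_next; exists k.
have chain n x : root f x ->
    exists s, [/\ size s = n, path <%R x s & all (root f) s].
  elim: n x => [|n IH] x fx; first by exists [::].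
  have [k [k_gt0 fk]] := next x fx; have [s [<- sk fs]] := IH _ fk.
  by exists (x + k%:R :: s); rewrite /= fk sk fs ltrDl ltr0n k_gt0.
have [s [sf sa fs]] := chain (size f) a fa.
have us : uniq s by apply: lt_sorted_uniq; exact: path_sorted sa.
by have := max_poly_roots f0 fs us; rewrite sf ltnn.
Qed.

Lemma weight_part0_comp (K : fieldType) p q (L : diffop K) :
    (0 < q)%N -> coprime p q -> exists f, weight_part p q 0 L = f \Po 'X^q.
Proof.
move=> q_gt0 coprime_pq; pose Q := weight_part p q 0 L.
exists (\poly_(m < size Q) Q`_(q * m)); apply/polyP => i.
rewrite coef_comp_poly_Xn // -/Q; case: ifP => [d|].
  rewrite coef_poly mulnC divnK //; case: ltnP => // Qi.
  by rewrite nth_default // (leq_trans Qi) // leq_div.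
rewrite /Q coef_weight_part addn0 Gauss_dvdr; last by rewrite coprime_sym.
by move=> ->.
Qed.

Lemma comp_polyXn_class (K : fieldType) p q (f : {poly K}) : (0 < q)%N ->
  f \Po 'X^q \in weight_class p q 0.
Proof.
move=> q_gt0; apply/weight_classP => i; rewrite coef_comp_poly_Xn // addn0.
by case: ifP => [d _|]; rewrite ?eqxx // dvdn_mull.
Qed.

(** For slope 0, [q = 1] and the twist moves the test for a common root from [x] to [x + k]. For
    positive slope there is no twist, and coprimality survives substituting ['X^q]. *)
Lemma coprimep_twist_XsubC (K : fieldType) p q k x m (g : {poly K}) :
    (0 < q)%N -> coprime p q -> ~~ root g x -> ~~ root g (x + k%:R) ->
  coprimep (twist p q k (g \Po 'X^q)) (('X - x%:P) ^+ m \Po 'X^q).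
Proof.
move=> q_gt0 coprime_pq gx gk; rewrite /twist; have [p0|_] := eqVneq p 0%N.
  have -> : q = 1%N by move: coprime_pq; rewrite p0 /coprime gcd0n => /eqP.
  rewrite expr1 !comp_polyXr divn1 coprimep_expr // coprimep_XsubC.
  by rewrite rootE horner_comp !hornerE -rootE.
by apply: coprimep_comp_poly; rewrite coprimep_expr // coprimep_XsubC.
Qed.

Lemma monic_or_reducible (R : realType) (L : diffop R[i]) : (0 < dorder L)%N ->
  monic_op L \/ exists A B, [/\ L = A * B, (0 < dorder A < dorder L)%N
    & (0 < dorder B < dorder L)%N].
Proof.
move=> L_gt0; have [p [q [q_gt0 coprime_pq L_ge Q_gt1]]] := newton_slope_exists L_gt0.
have [f Qf] := weight_part0_comp L q_gt0 coprime_pq.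
set Q := weight_part p q 0 L in Q_gt1 Qf.
have Q0 : Q != 0 by rewrite -size_poly_gt0 ltnW.
(* With [d] the degree of [B0], the factors have orders at most [n - d] and [d], while their sum is
   at least [n]. Both bounds are thus equalities, and [0 < d < n] makes both orders positive and
   smaller than [n]. *)
have split_at A0 B0 : Q = A0 * B0 -> A0 \in weight_class p q 0 ->
    B0 \in weight_class p q 0 -> (1 < size B0 <= dorder L)%N ->
    (forall k, (0 < k)%N -> coprimep (twist p q k A0) B0) ->
  exists A B, [/\ L = A * B, (0 < dorder A < dorder L)%N & (0 < dorder B < dorder L)%N].
  move=> QAB cA cB /andP[B_gt1 B_le] cop.
  have /norP[A0_neq0 B0_neq0] : ~~ ((A0 == 0) || (B0 == 0)) by rewrite -mulf_eq0 -QAB.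
  have [A [B [LAB sA sB]]] :=
    weight_part_factor q_gt0 L_ge QAB A0_neq0 B0_neq0 cA cB cop.
  have := dorderM_leq A B; rewrite -LAB => L_le; exists A, B.
  move: B_gt1 B_le sA sB L_le LAB.
  by move: (size B0) (dorder A) (dorder B) (dorder L) => b i j n; split=> //; lia.
have [sQ|sQ] := leqP (size Q) (dorder L).
  right; apply: (split_at 1 Q); rewrite ?mul1r ?Q_gt1 //.
  - have -> : 1 = 1%:P \Po 'X^q :> {poly R[i]} by rewrite comp_polyC.
    exact: comp_polyXn_class.
  - exact: weight_part_class.
  - move=> k _; rewrite /twist; case: ifP => _; rewrite ?[shiftp _ _]comp_polyC;
    exact: coprime1p.
have {}sQ : size Q = (dorder L).+1.
  by apply/eqP; rewrite eqn_leq sQ size_weight_part.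
(* If the nonzero roots do not all coincide, [f] has two distinct roots. *)
have [[l fl]|no_l] := pselect (exists l, forall a, root f a -> a != 0 -> a = l).
  by left; exact: (monic_op_slope q_gt0 coprime_pq L_gt0 L_ge sQ Qf fl).
right.
have [a [b [fa fb ab]]] : exists a b, [/\ root f a, root f b & a != b].
  apply: contrapT => H; apply: no_l.
  have [[a fa]|no_a] := pselect (exists a, root f a); last first.
    by exists 0 => a fa; case: no_a; exists a.
  exists a => b fb _; apply/eqP; rewrite eq_sym; apply: contraT => ab.
  by case: H; exists a, b.
have f0 : f != 0 by apply: contra_neq Q0 => f0; rewrite Qf f0 comp_poly0.
have [x [fx x_max]] := maximal_root f0 fa.
have [m [g]] := multiplicity_XsubC f x; rewrite f0 /= => gx Ef.
have groot y : root f y -> y != x -> root g y.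
  move=> fy yx; move: fy; rewrite Ef rootM => /orP[//|].
  have [->|m_gt0] := posnP m; first by rewrite expr0 (negPf (root1 _)).
  by rewrite rootE horner_exp expf_eq0 m_gt0 /= !hornerE subr_eq0 (negPf yx).
(* One of the two roots differs from [x]; it makes [g] nonconstant, so the degree of [B0] stays
   below [n]. *)
have [y gy] : exists y, root g y.
  have [ax|ax] := eqVneq a x; last by exists a; exact: groot.
  by exists b; apply: groot => //; rewrite -ax eq_sym.
have m_gt0 : (0 < m)%N.
  by rewrite lt0n; apply: contraNneq gx => m0; move: fx; rewrite Ef m0 expr0 mulr1.
have QAB : Q = (g \Po 'X^q) * (('X - x%:P) ^+ m \Po 'X^q).
  by rewrite Qf Ef comp_polyM.
have size_comp (h : {poly R[i]}) : (size (h \Po 'X^q)).-1 = ((size h).-1 * q)%N.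
  by rewrite size_comp_poly size_polyXn.
have g_gt1 : (1 < size g)%N.
  apply: root_size_gt1 gy.
  by apply: contraNneq f0 => g0; rewrite Ef g0 mul0r.
apply: (split_at _ _ QAB); try exact: comp_polyXn_class.
  have gq_gt0 : (0 < (size g).-1 * q)%N by rewrite muln_gt0 q_gt0 -subn1 subn_gt0 g_gt1.
  have mq_gt0 : (0 < m * q)%N by rewrite muln_gt0 m_gt0.
  have := size_comp (('X - x%:P) ^+ m); rewrite size_exp_XsubC /= => size_B.
  rewrite -size_comp in gq_gt0; rewrite -size_B in mq_gt0.
  move: sQ; rewrite QAB size_mul; last 2 first.
  - by apply: contraTneq gq_gt0 => ->; rewrite size_poly0.
  - by apply: contraTneq mq_gt0 => ->; rewrite size_poly0.
  by move: gq_gt0 mq_gt0; move: (size _) (size _) => i j; lia.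
move=> k k_gt0; apply: coprimep_twist_XsubC => //.
by apply: contraNN (x_max k k_gt0); rewrite Ef rootM => ->.
Qed.

Theorem theorem11 (R : realType) (L : diffop R[i]) (hL : (0 < dorder L)%N) :
  exists s : seq (diffop R[i]),
    (forall M, M \in s -> monic_op M) /\ L = \prod_(M <- s) M.
Proof.
have [n] := ubnP (dorder L); elim: n L hL => // n IH L hL; rewrite ltnS => Ln.
have [Lm|[A [B [LAB /andP[A_gt0 AL] /andP[B_gt0 BL]]]]] := monic_or_reducible hL.
  by exists [:: L]; rewrite big_seq1; split=> // M; rewrite inE => /eqP ->.
have [s [sm As]] := IH A A_gt0 (leq_trans AL Ln).
have [r [rm Br]] := IH B B_gt0 (leq_trans BL Ln).
exists (s ++ r); rewrite big_cat /= -As -Br; split=> // M.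
by rewrite mem_cat => /orP[/sm|/rm].
Qed.
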